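(* Let $m\in\{1,2\}$, $q=m+1$, $V_*=2(m+2)$, $T>0$, and let $(U,V,G)$ be the self-similar profile, with exponent $c$, described in the context. Let $$u_{\rm ss}(t,x)=\tfrac1{T-t}U\bigl(\tfrac{x}{(T-t)^c}\bigr),\quad v_{\rm ss}(t,x)=\tfrac1{T-t}V\bigl(\tfrac{x}{(T-t)^c}\bigr),\quad g_{\rm ss}(t,x)=\tfrac1{T-t}G\bigl(\tfrac{x}{(T-t)^c}\bigr)$$ be the corresponding horizontal-axis self-similar solution of (R0). Suppose this horizontal-axis trace is realized by a smooth axisymmetric Euler field $\boldsymbol v$ on $0\le t<T$ whose Hou–Li variables $(\mathcal U,\mathcal V,\mathcal G)$ satisfy $$(\mathcal U,\mathcal V,\mathcal G)(t,x,0)=(u_{\rm ss},v_{\rm ss},g_{\rm ss})(t,x)$$ on the symmetry axis $\theta=0$. Then $$\int_0^T\|\nabla\boldsymbol v(t)\|_{L^\infty}\,dt=\infty .$$ More precisely, for every $0<t<T$, $$\|\nabla\boldsymbol v(t)\|_{L^\infty}\ge|v_{\rm ss}(t,0)|=\frac{V_*}{T-t}=\frac{2(m+2)}{T-t}.$$ Consequently the finite-time blow-up of the self-similar solution is detected by the $L^\infty$ strain criterion $\int_0^T\|\nabla\boldsymbol v(t)\|_{L^\infty}\,dt=\infty$.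
   Context: Parameters: $\lambda=\frac{m+2}{m+1}m^2$, $\mu=\frac{3m+2}{2(m+1)-m^2}m^2$; $c=\frac{33}{14}$ for $m=1$ and $c=\frac85$ for $m=2$. System (R0) for functions of $(t,x)$, $x\ge0$: $$\lambda u_t=xvu_x+\tfrac{m^2}{2}vu,\quad g=mv+xv_x,$$ $$\lambda\Bigl(v+\tfrac{1}{\mu+m}xv_x\Bigr)_t=\tfrac{\mu-m^2}{\mu+m}v^2-\tfrac{\mu}{\mu+m}u^2+\tfrac{\mu+1-m}{\mu+m}xvv_x-\tfrac{1}{\mu+m}x^2\bigl(v_x^2-vv_{xx}\bigr).$$ The self-similar profile: $U\equiv0$, $V$ is a $C^2$ function on $[0,\infty)$, smooth at $0$, $G=mV+\xi V_\xi$, such that $$\xi^2V_{\xi\xi}(V-c\lambda)-(\xi V_\xi)^2+\xi V_\xi\bigl(-c\lambda(\mu+m+1)-\lambda+(\mu-m+1)V\bigr)+(\mu-m^2)V^2-\lambda(\mu+m)V=0,$$ $V(\xi)=V_*-a_m\xi^2+O(\xi^4)$ as $\xi\downarrow0$ (so $V(0)=V_*$), and $V(\xi)=b_m\xi^{-1/c}(1+o(1))$, $G(\xi)=(m-\frac1c)b_m\xi^{-1/c}(1+o(1))$ as $\xi\to\infty$, for constants $a_m,b_m>0$. The velocity field in cylindrical coordinates is $\boldsymbol v=-r\,\mathcal V e_r+r\,\mathcal U e_\phi+z\,\mathcal G e_z$, where the Hou–Li variables $\mathcal U,\mathcal V,\mathcal G$ are smooth functions of $(t,x,\theta)$, $r=x\cos\theta$,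 $z=x\sin\theta$, even in $r$ and in $z$ (in particular their $\theta$-derivatives vanish at $\theta=0,\pi/2$). The cylindrical gradient matrix is $$\nabla\boldsymbol v=\begin{pmatrix}-(\mathcal V+r\mathcal V_r)&\mathcal U+r\mathcal U_r&z\mathcal G_r\\-\mathcal U&-\mathcal V&0\\-r\mathcal V_z&r\mathcal U_z&\mathcal G+z\mathcal G_z\end{pmatrix},$$ $|\nabla\boldsymbol v|$ is its Frobenius norm, and $\|F(t)\|_{L^\infty}=\sup_{x\ge0,\,0\le\theta\le\pi/2}|F(t,x,\theta)|$. *)

(* Defs.v *)
From mathcomp Require Import all_boot all_order all_algebra.
From mathcomp Require Import all_classical all_reals all_analysis.
From mathcomp Require Import ring lra.

Set Implicit Arguments.
Unset Strict Implicit.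
Unset Printing Implicit Defensive.

Import Order.TTheory GRing.Theory Num.Theory.
Import numFieldNormedType.Exports.

Local Open Scope classical_set_scope.
Local Open Scope ring_scope.

Section Constants.
Context {R : realType}.
Implicit Type m : nat.

Definition lam m : R := (m%:R + 2) / (m%:R + 1) * m%:R ^+ 2.

Definition mu m : R :=
  (3 * m%:R + 2) / (2 * (m%:R + 1) - m%:R ^+ 2) * m%:R ^+ 2.

Definition Vstar m : R := 2 * (m%:R + 2).

(* Only [m = 1] and [m = 2] are meaningful. *)
Definition cexp m : R := if m == 1%N then 33 / 14 else 8 / 5.

End Constants.

Section SystemR0.
Context {R : realType}.
Implicit Types u v g : R -> R -> R.

Definition dt2 v (t x : R) : R := derive1 (fun s : R => v s x) t.
Definition dx2 v (t x : R) : R := derive1 (fun y : R => v t y) x.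

(* Every [x]-derivative carries a factor [x], so at [x = 0] the (two-sided)
   derivatives taken there are irrelevant. *)
Definition solves_R0 (m : nat) (T : R) u v g : Prop :=
  forall t x : R, 0 < t < T -> 0 <= x ->
  [/\ lam m * dt2 u t x
        = x * v t x * dx2 u t x + m%:R ^+ 2 / 2 * v t x * u t x,
      g t x = m%:R * v t x + x * dx2 v t x
    & lam m * dt2 (fun s y => v s y + (mu m + m%:R)^-1 * (y * dx2 v s y)) t x
        = (mu m - m%:R ^+ 2) / (mu m + m%:R) * v t x ^+ 2
          - mu m / (mu m + m%:R) * u t x ^+ 2
          + (mu m + 1 - m%:R) / (mu m + m%:R) * (x * v t x * dx2 v t x)
          - (mu m + m%:R)^-1
            * (x ^+ 2 * (dx2 v t x ^+ 2 - v t x * dx2 (dx2 v) t x))].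

End SystemR0.

Section Profile.
Context {R : realType}.
Implicit Types (U V G f : R -> R).

(* [f] is [C^k] on the set [A], up to the part of the boundary lying in [A]:
   its derivatives on the interior extend continuously to [A]. *)
Definition Ck_on (k : nat) (A : set R) f : Prop :=
  exists d : nat -> R -> R,
  [/\ forall x, A x -> d 0%N x = f x,
      forall j, (j <= k)%N -> {within A, continuous (d j)}
    & forall j, (j < k)%N -> forall x, A^° x ->
        is_derive x (1 : R) (d j) (d j.+1 x)].

Definition smooth_on (A : set R) f : Prop := forall k, Ck_on k A f.

(* Only the values on [[0, +oo)] matter.  At [xi = 0] the derivatives
   of [V] occur with a factor [xi] or [xi ^+ 2]. *)
Record is_profile (m : nat) U V G : Prop := IsProfile {
  profile_U : forall xi, 0 <= xi -> U xi = 0 ;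
  profile_C2 : Ck_on 2 `[0, +oo[ V ;
  profile_smooth0 : exists2 delta : R, 0 < delta & smooth_on `[0, delta[ V ;
  profile_G : forall xi, 0 <= xi -> G xi = m%:R * V xi + xi * derive1 V xi ;
  profile_ode : forall xi, 0 <= xi ->
    let c := cexp m in let l := lam m in let n := mu m in
    xi ^+ 2 * derive1 (derive1 V) xi * (V xi - c * l) - (xi * derive1 V xi) ^+ 2
    + xi * derive1 V xi
      * (- (c * l * (n + m%:R + 1)) - l + (n - m%:R + 1) * V xi)
    + (n - m%:R ^+ 2) * V xi ^+ 2 - l * (n + m%:R) * V xi = 0 ;
  profile_V0 : V 0 = Vstar m ;
  profile_at0 : exists2 a : R, 0 < a &
    (fun xi : R => V xi - (Vstar m - a * xi ^+ 2))
      =O_ (0^'+) (fun xi : R => xi ^+ 4) ;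
  profile_infty : exists2 b : R, 0 < b &
    (V xi / (b * xi `^ (- (cexp m)^-1)) @[xi --> +oo] --> (1 : R)) /\
    (G xi / ((m%:R - (cexp m)^-1) * b * xi `^ (- (cexp m)^-1))
       @[xi --> +oo] --> (1 : R))
}.

Definition self_similar (c T : R) f (t x : R) : R :=
  (T - t)^-1 * f (x / (T - t) `^ c).

End Profile.

(* The profile equations are exactly (R0) in self-similar variables. *)
Section SelfSimilarSolution.
Context {R : realType}.
Implicit Types (U V G f : R -> R).

Let is_derive_eq_val f (x a b : R) :
  is_derive x (1 : R) f a -> a = b -> is_derive x (1 : R) f b.
Proof. by move=> h <-. Qed.

Let is_derive_scale f (k x a : R) :
  is_derive x (1 : R) f a -> is_derive x (1 : R) (fun z => k * f z) (k * a).
Proof. by move=> h; exact: (is_deriveZ k h). Qed.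

Let ss_dx (c T t x f' : R) f : t < T ->
  is_derive (x / (T - t) `^ c) (1 : R) f f' ->
  is_derive x (1 : R) (self_similar c T f t)
    ((T - t)^-1 * (f' / (T - t) `^ c)).
Proof.
move=> tT hf; rewrite /self_similar.
set P := (T - t) `^ c in hf *.
have h1 : is_derive x (1 : R) (fun z : R => z / P) P^-1.
  have -> : (fun z : R => z / P) = (fun z => P^-1 * id z).
    by apply/funext => z /=; rewrite mulrC.
  by rewrite -[P^-1 in X in is_derive _ _ _ X]mulr1; exact: is_derive_scale.
have h2 := @is_derive1_comp R f (fun z : R => z / P) x f' P^-1 hf h1.
exact: (is_derive_scale _ h2).
Qed.

Let ss_dt (c T t x f' : R) f : t < T ->
  is_derive (x / (T - t) `^ c) (1 : R) f f' ->
  is_derive t (1 : R) (fun s : R => self_similar c T f s x)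
    ((T - t)^-1 ^+ 2
     * (f (x / (T - t) `^ c) + c * (x / (T - t) `^ c * f'))).
Proof.
move=> tT hf; have s0 : 0 < T - t by rewrite subr_gt0.
set y := x / _ in hf *.
have hT : is_derive t (1 : R) (fun s : R => T - s) (- 1).
  have -> : (fun s : R => T - s) = cst T - (id : R -> R) by [].
  by apply: is_derive_eq_val; rewrite sub0r.
have hP a : is_derive t (1 : R) (fun s : R => (T - s) `^ a)
    (- (a * (T - t) `^ (a - 1))).
  apply: (is_derive_eq_val (@is_derive1_comp R (@powR R ^~ a) (fun s => T - s)
    t _ _ (is_derive1_powR a s0) hT)).
  by rewrite mulrN1.
have hy : is_derive t (1 : R) (fun s : R => x / (T - s) `^ c)
    (c * y / (T - t)).
  have -> : (fun s : R => x / (T - s) `^ c)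
          = (fun s : R => x * (T - s) `^ (- c)).
    by apply/funext => s /=; rewrite powRN.
  apply: (is_derive_eq_val (is_derive_scale x (hP (- c)))).
  rewrite mulNr opprK /y powRD; last first.
    by rewrite (gt_eqF s0) implybT.
  rewrite powRN powR_inv1 ?ltW//; ring.
have hi : is_derive t (1 : R) (fun s : R => (T - s)^-1) ((T - t)^-1 ^+ 2).
  apply: (is_derive_eq_val (is_deriveV _ hT)); first by rewrite gt_eqF.
  by rewrite /GRing.scale /= mulrN1 opprK exprVn.
have hc := @is_derive1_comp R f (fun s : R => x / (T - s) `^ c) t f' _ hf hy.
rewrite /self_similar.
have -> : (fun s : R => (T - s)^-1 * f (x / (T - s) `^ c))
  = (fun s : R => (T - s)^-1) * (f \o (fun s : R => x / (T - s) `^ c)) by [].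
apply: (is_derive_eq_val (is_deriveM hi hc)).
by rewrite /GRing.scale /= -/y; ring.
Qed.

Lemma profile_solves_R0 (m : nat) (T : R) U V G :
  m = 1%N \/ m = 2%N -> is_profile m U V G ->
  solves_R0 m T (self_similar (cexp m) T U) (self_similar (cexp m) T V)
    (self_similar (cexp m) T G).
Proof.
move=> hm [HU [d [d0 dcont dd]] _ HG ode _ _ _] t x /andP[_ tT] x0.
have s0 : 0 < T - t by rewrite subr_gt0.
have M0 : mu m + m%:R != 0 :> R.
  have -> : mu m = (if m == 1%N then 5 / 3 else 16) :> R.
    by case: hm => ->; rewrite /mu /=; field; lra.
  by case: hm => -> /=; rewrite lt0r_neq0 //; lra.
have nearpos (y : R) : 0 < y -> \forall z \near y, 0 < z by exact: lt_nbhsr.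
have int (y : R) : 0 < y -> (`[0, +oo[%classic : set R)^° y.
  move=> y0; near=> z.
  have z0 : 0 < z by near: z; exact: nearpos.
  by rewrite /= in_itv /= ltW.
have inn (y : R) : 0 < y -> (`[0, +oo[%classic : set R) y.
  by move=> y0; rewrite /= in_itv /= ltW.
have hV1 (y : R) : 0 < y -> is_derive y (1 : R) V (d 1%N y).
  move=> y0; apply: (near_eq_is_derive _ (dd 0%N isT y (int y y0))).
  by near=> z; apply/d0/inn; near: z; exact: nearpos.
have eV1 (y : R) : 0 < y -> derive1 V y = d 1%N y.
  by move=> y0; rewrite derive1E; have [_ ->] := hV1 y y0.
have hV2 (y : R) : 0 < y -> is_derive y (1 : R) (derive1 V) (d 2%N y).
  move=> y0; apply: (near_eq_is_derive _ (dd 1%N isT y (int y y0))).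
  by near=> z; apply/esym/eV1; near: z; exact: nearpos.
have eV2 (y : R) : 0 < y -> derive1 (derive1 V) y = d 2%N y.
  by move=> y0; rewrite derive1E; have [_ ->] := hV2 y y0.
set c := cexp m; set k := (mu m + m%:R)^-1 : R.
have Pgt0 s : s < T -> 0 < (T - s) `^ c.
  by move=> sT; rewrite powR_gt0 // subr_gt0.
have ygt0 s z : s < T -> 0 < z -> 0 < z / (T - s) `^ c.
  by move=> sT z0; rewrite divr_gt0 // Pgt0.
have yge0 s z : s < T -> 0 <= z -> 0 <= z / (T - s) `^ c.
  by move=> sT z0; rewrite divr_ge0 // ltW // Pgt0.
have edx s z : s < T -> 0 < z -> dx2 (self_similar c T V) s z
    = (T - s)^-1 * (derive1 V (z / (T - s) `^ c) / (T - s) `^ c).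
  move=> sT z0; rewrite /dx2 derive1E eV1 ?ygt0 //.
  by have [_ ->] := ss_dx sT (hV1 _ (ygt0 _ _ sT z0)).
have exdx s z : s < T -> 0 <= z -> z * dx2 (self_similar c T V) s z
    = (T - s)^-1 * (z / (T - s) `^ c * derive1 V (z / (T - s) `^ c)).
  move=> sT; rewrite le_eqVlt => /orP[/eqP <-|z0]; first by rewrite !mul0r mulr0.
  by rewrite edx //; ring.
have eU s z : s < T -> 0 <= z -> self_similar c T U s z = 0.
  by move=> sT z0; rewrite /self_similar HU ?mulr0 // yge0.
have nearT : \forall s \near t, s < T by exact: lt_nbhsl.
split.
- rewrite (eU t x) // mulr0 addr0.
  have -> : dt2 (self_similar c T U) t x = 0.
    rewrite /dt2 derive1E.
    suff [_ ->] : is_derive t (1 : R) (fun s => self_similar c T U s x) 0 by [].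
    apply: (near_eq_is_derive _ (is_derive_cst 0 t 1)).
    by near=> s; rewrite /= eU //; near: s.
  suff -> : x * self_similar c T V t x * dx2 (self_similar c T U) t x = 0.
    by rewrite mulr0.
  move: x0; rewrite le_eqVlt => /orP[/eqP <-|x0]; first by rewrite !mul0r.
  suff -> : dx2 (self_similar c T U) t x = 0 by rewrite mulr0.
  rewrite /dx2 derive1E.
  suff [_ ->] : is_derive x (1 : R) (self_similar c T U t) 0 by [].
  apply: (near_eq_is_derive _ (is_derive_cst 0 x 1)).
  near=> z; rewrite /= eU // ltW //; near: z; exact: nearpos.
- by rewrite exdx // /self_similar HG ?yge0 //; ring.
pose F (y : R) := V y + k * (y * derive1 V y).
set y := x / (T - t) `^ c.
have odey := ode y (yge0 _ _ tT x0).
have eF : dt2 (fun s z => self_similar c T V s z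
    + k * (z * dx2 (self_similar c T V) s z)) t x
  = (T - t)^-1 ^+ 2 * (F y + c * (y * derive1 V y
      + k * (y * derive1 V y + y ^+ 2 * derive1 (derive1 V) y))).
  rewrite /dt2 derive1E.
  set D := (X in _ = X).
  suff [_ ->] : is_derive t (1 : R) (fun s => self_similar c T V s x
    + k * (x * dx2 (self_similar c T V) s x)) D by [].
  apply: (@near_eq_is_derive R _ _ (fun s => self_similar c T F s x)).
    near=> s; have sT : s < T by near: s.
    by rewrite exdx // /self_similar /F; ring.
  move: x0; rewrite le_eqVlt => /orP[/eqP e0|xpos].
    have y0 : y = 0 by rewrite /y -e0 mul0r.
    have -> : (fun s => self_similar c T F s x)
            = (fun s => self_similar c T (cst (F 0)) s x).
      by apply/funext => s; rewrite /self_similar -e0 mul0r.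
    apply: (is_derive_eq_val (ss_dt tT (is_derive_cst (F 0) _ _))).
    by rewrite /D y0 /=; ring.
  have ypos : 0 < y by exact: ygt0.
  have h1 := hV1 y ypos; have h2 := hV2 y ypos.
  have hF : is_derive y (1 : R) F
      (d 1%N y + k * (d 1%N y + y * d 2%N y)).
    have -> : F = V + (fun z => k * ((id : R -> R) * derive1 V) z) by [].
    apply: (is_derive_eq_val (is_deriveD h1 (is_derive_scale k
      (is_deriveM (is_derive_id y (1 : R)) h2)))).
    by rewrite /GRing.scale /= eV1 //; ring.
  apply: (is_derive_eq_val (ss_dt tT hF)).
  by rewrite /D -/y eV1 // eV2 //; ring.
have edxx : x ^+ 2 * dx2 (dx2 (self_similar c T V)) t x
    = (T - t)^-1 * (y ^+ 2 * derive1 (derive1 V) y).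
  have := x0; rewrite le_eqVlt => /orP[/eqP e0|xpos].
    by rewrite /y -e0 mul0r !expr0n !mul0r mulr0.
  have P0 : (T - t) `^ c != 0 by rewrite gt_eqF // Pgt0.
  suff -> : dx2 (dx2 (self_similar c T V)) t x
      = (T - t)^-1 * (derive1 (derive1 V) y / (T - t) `^ c) / (T - t) `^ c.
    by rewrite /y; ring.
  rewrite {1}/dx2 derive1E.
  set D := (X in _ = X).
  suff [_ ->] : is_derive x (1 : R) (dx2 (self_similar c T V) t) D by [].
  apply: (@near_eq_is_derive R _ _
    (fun z => ((T - t) `^ c)^-1 * self_similar c T (derive1 V) t z)).
    near=> z; rewrite /= edx //; last by near: z; exact: nearpos.
    by rewrite /self_similar; ring.
  have ypos : 0 < y by exact: ygt0.
  apply: (is_derive_eq_val (is_derive_scale _ (ss_dx tT (hV2 y ypos)))).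
  by rewrite /D /GRing.scale /= eV2 //; ring.
have -> : x ^+ 2 * (dx2 (self_similar c T V) t x ^+ 2
      - self_similar c T V t x * dx2 (dx2 (self_similar c T V)) t x)
  = (x * dx2 (self_similar c T V) t x) ^+ 2
    - self_similar c T V t x * (x ^+ 2 * dx2 (dx2 (self_similar c T V)) t x).
  by ring.
rewrite eF edxx (eU t x) //.
have -> : x * self_similar c T V t x * dx2 (self_similar c T V) t x
  = self_similar c T V t x * (x * dx2 (self_similar c T V) t x) by ring.
rewrite exdx // -/y.
have -> : self_similar c T V t x = (T - t)^-1 * V y by [].
rewrite /F /k; move: odey; rewrite -/c /=.
set A := y * derive1 V y; set B := y ^+ 2 * derive1 (derive1 V) y.
move: (V y) => W; move: (T - t)^-1 => i odey.
apply/(mulfI M0)/eqP; rewrite -subr_eq0; apply/eqP.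
transitivity (- (i ^+ 2 * (B * (W - c * lam m) - A ^+ 2 +
        A * (- (c * lam m * (mu m + m%:R + 1)) - lam m + (mu m - m%:R + 1) * W)
        + (mu m - m%:R ^+ 2) * W ^+ 2 - lam m * (mu m + m%:R) * W))).
  by field.
by rewrite odey mulr0 oppr0.
Unshelve. all: by end_near.
Qed.

End SelfSimilarSolution.

(* Hou-Li variables are functions of [(t, r, z)] on the whole [(r, z)]-plane. *)
Section AxisymmetricFields.
Context {R : realType}.
Implicit Types (F U V G p : R -> R -> R -> R).

Definition polar {S : Type} (F : R -> R -> R -> S) (t x theta : R) : S :=
  F t (x * cos theta) (x * sin theta).

Definition dt F (t r z : R) : R := derive1 (fun s : R => F s r z) t.
Definition dr F (t r z : R) : R := derive1 (fun s : R => F t s z) r.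
Definition dz F (t r z : R) : R := derive1 (fun s : R => F t r s) z.

(* [C^infinity] on [[0, T) x R^2], up to [t = 0]: [d i j k] is the derivative
   of order [(i, j, k)] in [(t, r, z)]. *)
Definition smooth_field (T : R) F : Prop :=
  exists2 d : nat -> nat -> nat -> R -> R -> R -> R,
    forall t r z, 0 <= t < T -> d 0%N 0%N 0%N t r z = F t r z &
    forall i j k,
      {within [set q : R * R * R | 0 <= q.1.1 < T],
        continuous (fun q : R * R * R => d i j k q.1.1 q.1.2 q.2)} /\
      forall t r z, 0 < t < T ->
      [/\ is_derive t (1 : R) (fun s : R => d i j k s r z) (d i.+1 j k t r z),
          is_derive r (1 : R) (fun s : R => d i j k t s z) (d i j.+1 k t r z)
        & is_derive z (1 : R) (fun s : R => d i j k t r s) (d i j k.+1 t r z)].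

Definition even_rz (T : R) F : Prop :=
  forall t r z, 0 <= t < T -> F t (- r) z = F t r z /\ F t r (- z) = F t r z.

Definition hou_li (T : R) F : Prop := smooth_field T F /\ even_rz T F.

Definition vel_r V (t r z : R) : R := - (r * V t r z).
Definition vel_phi U (t r z : R) : R := r * U t r z.
Definition vel_z G (t r z : R) : R := z * G t r z.

(* For [n = 2] and [kappa = 1]: the incompressible axisymmetric Euler equations
   with swirl on [R^3], in cylindrical components, with pressure [p].
   [kappa] is the unit of time ([kappa = lam m] in the normalization of (R0)).
   For [n = 1]: the planar counterpart behind (R0) with [m = 1], i.e. the
   two-dimensional Boussinesq system for the velocity [(vel_r, vel_z)] and the
   transported density [r * U ^+ 2].  For every [n] the swirl equation reads
   [kappa * U_t = r * V * U_r - z * G * U_z + n ^ 2 / 2 * V * U], and on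
   [z = 0] the divergence equation reads [G = n * V + r * V_r]. *)
Definition axisymmetric_euler (kappa : R) (n : nat) (T : R) U V G : Prop :=
  exists p : R -> R -> R -> R,
  forall t r z : R, 0 < t < T -> 0 < r ->
  let vr := vel_r V in let vphi := vel_phi U in let vz := vel_z G in
  let D F := kappa * dt F t r z + vr t r z * dr F t r z
             + vz t r z * dz F t r z in
  [/\ is_derive r (1 : R) (fun s : R => p t s z)
        (- (D vr - vphi t r z ^+ 2 / r)),
      D vphi + (n%:R ^+ 2 / 2 - 1) * (vr t r z * vphi t r z / r) = 0,
      is_derive z (1 : R) (fun s : R => p t r s) (- D vz)
    & dr vr t r z + (n%:R - 1) * (vr t r z / r) + dz vz t r z = 0].

Definition grad_field U V G (t r z : R) : 'M[R]_3 :=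
  \matrix_(i < 3, j < 3) nth 0 (nth [::]
    [:: [:: - (V t r z + r * dr V t r z);
            U t r z + r * dr U t r z;
            z * dr G t r z];
        [:: - U t r z; - V t r z; 0];
        [:: - (r * dz V t r z);
            r * dz U t r z;
            G t r z + z * dz G t r z]] i) j.

Definition frobenius k l (A : 'M[R]_(k, l)) : R :=
  Num.sqrt (\sum_(i < k) \sum_(j < l) A i j ^+ 2).

(* Possibly [+oo]. *)
Definition grad_Linfty U V G (t : R) : \bar R :=
  ereal_sup [set (frobenius (polar (grad_field U V G) t q.1 q.2))%:E
            | q in [set q : R * R | 0 <= q.1 /\ 0 <= q.2 <= pi / 2]].

End AxisymmetricFields.

(* Main.v *)
(* At the origin the [(2, 2)] entry of the gradient matrix is [- V], whatever
   the other entries are, so the Frobenius norm there is at least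
   [|v_ss (t, 0)| = Vstar / (T - t)], and [1 / (T - t)] has a logarithmically
   divergent integral on [[0, T)]. *)
Require Import Defs.
From mathcomp Require Import all_boot all_order all_algebra.
From mathcomp Require Import all_classical all_reals all_analysis.
From mathcomp Require Import lra.

Import Order.TTheory GRing.Theory Num.Theory.
Import numFieldNormedType.Exports.

Local Open Scope classical_set_scope.
Local Open Scope ring_scope.

(* The library's [ge0_le_integral] asks for the measurability of [g], which is
   not clear for the supremum [grad_Linfty]; the integral being a supremum over
   the simple functions below the integrand, monotonicity holds without it. *)
Lemma ge0_subset_le_integral d (X : measurableType d) (R : realType)
    (nu : {measure set X -> \bar R}) (A B : set X) (f g : X -> \bar R) :
  A `<=` B -> (forall x, A x -> (0 <= f x <= g x)%E) ->
  (forall x, B x -> (0 <= g x)%E) ->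
  (\int[nu]_(x in A) f x <= \int[nu]_(x in B) g x)%E.
Proof.
move=> AB fg g0.
rewrite !ge0_integralE //; last by move=> x /fg /andP[].
apply: ereal_sup_le => _ [h hf <-]; exists h => // x.
(* Outside [A] the extension of [f] is zero, hence below that of [g], which is nonnegative on [B]
   and zero off [B]. *)
apply: le_trans (hf x) _; rewrite /patch; case: ifPn => [|_].
  rewrite inE => Ax; rewrite mem_set; last exact: AB.
  by case/andP: (fg _ Ax).
by case: ifPn => //; rewrite inE => /g0.
Qed.

(** Fundamental theorem of calculus with antiderivative [- K * ln (T - t)]; stopping at [b < T]
    keeps away from the singularity. *)
Lemma integral_div_dist (R : realType) (K T b : R) : 0 < b < T ->
  (\int[lebesgue_measure]_(t in `[0%R, b]) (K / (T - t))%:E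
   = (K * ln (T / (T - b)))%:E)%E.
Proof.
case/andP=> b0 bT; pose F (t : R) := K * - ln (T - t).
(* This covers every [x < T], negative ones included, so the continuity needed at the endpoints [0]
   and [b] follows from differentiability. *)
have dF (x : R) : x < T -> is_derive x (1 : R) F (K / (T - x)).
  move=> xT; have Tx : 0 < T - x by rewrite subr_gt0.
  have dT : is_derive x (1 : R) (fun t : R => T - t) (- 1).
    rewrite -[- 1]add0r.
    exact: (is_deriveB (is_derive_cst T x 1) (is_derive_id x (1 : R))).
  have := is_deriveZ K (is_deriveN
    (@is_derive1_comp R (@ln R) (fun t : R => T - t) x _ _
      (is_derive1_ln Tx) dT)).
  by rewrite mulrN1 opprK.
have cF (x : R) : x < T -> F z @[z --> x] --> F x.
  move=> /dF[dFx _].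
  by apply: differentiable_continuous; rewrite -derivable1_diffP.
rewrite (@continuous_FTC2 _ _ F 0 b) //.
- rewrite -EFinB /F subr0 ln_div ?posrE; [|lra|lra].
  by congr EFin; lra.
- apply: continuous_in_subspaceT => x; rewrite inE /= in_itv /= => /andP[_ xb].
  apply: cvgM; first exact: cvg_cst.
  apply: cvgV; first by rewrite subr_eq0 gt_eqF // (le_lt_trans xb).
  by apply: cvgB; [exact: cvg_cst|exact: cvg_id].
- split.
  + move=> x; rewrite in_itv /= => /andP[_ xb].
    by have [] := dF x (lt_trans xb bT).
  + by apply: cvg_at_right_filter; apply: cF; lra.
  + by apply: cvg_at_left_filter; exact: cF.
- move=> x; rewrite in_itv /= => /andP[_ xb].
  by rewrite derive1E; have [_ ->] := dF x (lt_trans xb bT).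
Qed.

(** As [b] increases to [T], the integral of the minorant over [[0, b]] grows like a logarithm and
    exceeds every bound; [f] itself may be non-measurable. *)
Lemma integral_ge_div_dist_infty (R : realType) (T K : R) (f : R -> \bar R) :
  0 < T -> 0 < K ->
  (forall t, 0 <= t < T -> ((K / (T - t))%:E <= f t)%E) ->
  (\int[lebesgue_measure]_(t in `[0%R, T[%classic) f t = +oo)%E.
Proof.
move=> T0 K0 Kf.
have div0 (t : R) : t < T -> 0 <= K / (T - t).
  by move=> tT; rewrite divr_ge0 // ?subr_ge0 ltW.
(* Given a level [A > 0], this [b] is the solution of [K * ln (T / (T - b)) = A]. *)
apply/eqyP => A A0; pose b := T - T * expR (- (A / K)).
have AK : 0 < A / K by rewrite divr_gt0.
have e0 : 0 < T * expR (- (A / K)) by rewrite mulr_gt0 // expR_gt0.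
have eT : T * expR (- (A / K)) < T by rewrite gtr_pMr // expR_lt1; lra.
have b0T : 0 < b < T by rewrite /b; lra.
have -> : A = K * ln (T / (T - b)).
  have -> : T / (T - b) = expR (A / K).
    rewrite /b opprB addrC subrK expRN invfM invrK mulrA divff ?mul1r //.
    by rewrite gt_eqF.
  by rewrite expRK mulrC divfK // gt_eqF.
rewrite -integral_div_dist //; case/andP: b0T => _ bT.
apply: ge0_subset_le_integral => t /=; rewrite in_itv /= => /andP[t0 tb].
- by rewrite in_itv /= t0 (le_lt_trans tb).
- have tT := le_lt_trans tb bT.
  by rewrite lee_fin div0 //= Kf // t0.
- by apply: le_trans (Kf t _); rewrite ?t0 // lee_fin div0.
Qed.

Lemma entry_le_frobenius (R : realType) k l (M : 'M[R]_(k, l)) i j :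
  `|M i j| <= frobenius M.
Proof.
rewrite -sqrtr_sqr /frobenius ler_wsqrtr // (bigD1 i) //= (bigD1 j) //=.
rewrite -addrA lerDl addr_ge0 // sumr_ge0 // => ? _; first exact: sqr_ge0.
by rewrite sumr_ge0 // => ? _; exact: sqr_ge0.
Qed.

Lemma grad_Linfty_ge_V_origin (R : realType) (U V G : R -> R -> R -> R)
    (t : R) :
  (`|polar V t 0 0|%:E <= grad_Linfty U V G t)%E.
Proof.
apply: le_ereal_sup_tmp.
exists (frobenius (polar (grad_field U V G) t 0 0))%:E.
  exists (0, 0) => //=; split=> //.
  by rewrite lexx divr_ge0 // pi_ge0.
(* Indices start at 0, so [1 1] is the middle diagonal entry [- V], which involves no derivative. *)
rewrite lee_fin; apply: le_trans (@entry_le_frobenius R 3 3 _ 1 1).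
by rewrite /polar /grad_field mxE /= normrN.
Qed.

Lemma self_similar_origin (R : realType) (c T : R) (f : R -> R) (t : R) :
  self_similar c T f t 0 = f 0 / (T - t).
Proof. by rewrite /self_similar mul0r mulrC. Qed.

Theorem proposition5p3 (R : realType) (m q : nat)
  (hm : m = 1%N \/ m = 2%N) (hq : q = m.+1)
  (T : R) (hT : 0 < T)
  (U V G : R -> R) (hprofile : is_profile m U V G)
  (kappa : R) (hkappa : 0 < kappa) (n : nat) (hn : n = 2%N \/ n = m)
  (UU VV GG : R -> R -> R -> R)
  (hUU : hou_li T UU) (hVV : hou_li T VV) (hGG : hou_li T GG)
  (heuler : axisymmetric_euler kappa n T UU VV GG)
  (htrace : forall t x : R, 0 <= t < T -> 0 <= x ->
    [/\ polar UU t x 0 = self_similar (cexp m) T U t x,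
        polar VV t x 0 = self_similar (cexp m) T V t x
      & polar GG t x 0 = self_similar (cexp m) T G t x]) :
  (\int[lebesgue_measure]_(t in `[0%R, T[%classic) grad_Linfty UU VV GG t
     = +oo)%E
  /\
  (forall t : R, 0 < t < T ->
     [/\ (`|self_similar (cexp m) T V t 0|%R%:E <= grad_Linfty UU VV GG t)%E,
         `|self_similar (cexp m) T V t 0| = Vstar m / (T - t)
       & Vstar m / (T - t) = 2 * (m%:R + 2) / (T - t)]).
Proof.
have V0 : 0 < Vstar m :> R by rewrite /Vstar mulr_gt0 // ltr_wpDl.
have ssE (t : R) : t < T ->
    `|self_similar (cexp m) T V t 0| = Vstar m / (T - t).
  move=> tT; rewrite self_similar_origin (profile_V0 hprofile).
  by rewrite ger0_norm // divr_ge0 // ?subr_ge0 ltW.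
(* The time [t = 0] is included because the integral bound is required on all of [[0, T)]; the trace
   hypothesis at [x = 0] identifies [VV] at the origin with the profile. *)
have lower (t : R) : 0 <= t < T ->
    (`|self_similar (cexp m) T V t 0|%:E <= grad_Linfty UU VV GG t)%E.
  move=> tT; have [_ <- _] := htrace t 0 tT (lexx 0).
  exact: grad_Linfty_ge_V_origin.
split.
  apply: (@integral_ge_div_dist_infty _ T (Vstar m)) => // t tT.
  by rewrite -ssE ?lower //; case/andP: tT.
move=> t /andP[t0 tT]; split=> //; last exact: ssE.
by rewrite lower // ltW.
Qed.
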